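(* For any $\mathsf{i}\in\{0,1\}^d$ the formula $$C_{\mathsf{i}}=C_Q\,B_{\mathsf{i}}$$ holds, where $C_{\mathsf{i}}$ is the matrix representing the restrictions $\phi_1|_{T_{\mathsf{i}}},\dots,\phi_N|_{T_{\mathsf{i}}}$ in terms of the functions $\zeta^{\mathsf{i}}_{\mathsf{j}}$, $C_Q$ is the matrix representing $\phi_1|_Q,\dots,\phi_N|_Q$ in terms of the functions $\psi^Q_{\mathsf{j}}$, and $B_{\mathsf{i}}$ is the matrix of constraint coefficients representing the restrictions $\psi^Q_{\mathsf{j}}|_{T_{\mathsf{i}}}$ in terms of the functions $\zeta^{\mathsf{i}}_{\mathsf{j}}$.
   Context: $\Omega\subset\mathbb{R}^d$ is a bounded Lipschitz domain with a decomposition $\mathcal{Q}$ into transformed hexahedra, i.e. each $Q\in\mathcal{Q}$ is the image of $\widehat Q:=[-1,1]^d$ under a bijective element mapping $F_Q:\widehat Q\to Q$. $\mathbb{P}_r(\widehat Q)$ is the space of polynomials on $\widehat Q$ of degree at most $r$ in each variable. $\mathbb{X}:=\{v\in H^1(\Omega):v=0\text{ on }\Gamma_D\}$ with $\Gamma_D\subseteq\partial\Omega$ of positive surface measure, and $\mathbb{W}:=\{v\in\mathbb{X}:v|_Q\circ F_Q\in\mathbb{P}_{p_Q}(\widehat Q)\ \forall Q\in\mathcal{Q}\}$ has basis $\phi_1,\dots,\phi_N$. Fix $Q\in\mathcal{Q}$. One-dimensional functions on $[-1,1]$: $\psi_0(t):=\frac12(1-t)$, $\psi_1(t):=\frac12(1+t)$,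 $\psi_j(t):=\int_{-1}^tL_{j-1}(s)\,ds$ for $j\ge2$, where $L_j$ is the $j$-th Legendre polynomial with $L_j(-1)=(-1)^j$. For $\mathsf{j}\in\mathbb{N}_0^d$, $\widehat\psi_{\mathsf{j}}(x):=\prod_{k=1}^d\psi_{j_k}(x_k)$; one has $\mathbb{P}_r(\widehat Q)=\operatorname{span}\{\widehat\psi_{\mathsf{j}}:0\le j_k\le r\}$, and $\psi^Q_{\mathsf{j}}:=\widehat\psi_{\mathsf{j}}\circ F_Q^{-1}$ on $Q$. Refinement. Given $\hat z\in(-1,1)^d$, $\widehat Q$ is divided into the $2^d$ sub-hexahedra $\widehat T_{\mathsf{i}}$, $\mathsf{i}\in\{0,1\}^d$, where $\widehat T_{\mathsf{i}}$ is the product of the intervals $[-1,\hat z_k]$ if $i_k=0$ and $[\hat z_k,1]$ if $i_k=1$; $T_{\mathsf{i}}:=F_Q(\widehat T_{\mathsf{i}})$; $F_{\mathsf{i}}:\widehat Q\to T_{\mathsf{i}}$ is the bijection obtained by composing $F_Q$ with the coordinatewise increasing affine map $\widehat Q\to\widehat T_{\mathsf{i}}$; $\zeta_{\mathsf{j}}^{\mathsf{i}}:=\widehat\psi_{\mathsf{j}}\circ F_{\mathsf{i}}^{-1}$ on $T_{\mathsf{i}}$. Matrices. Fix a finite (ordered) index set $J=\{\mathsf{j}\in\mathbb{N}_0^d:0\le j_k\le P\}$ with $P\ge p_Q$. The matrices $C_Q=(c^Q_{m\mathsf{j}})$, $C_{\mathsf{i}}=(c^{\mathsf{i}}_{m\mathsf{j}})$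 (of size $N\times|J|$) and $B_{\mathsf{i}}=(b^{\mathsf{i}}_{\mathsf{j}\mathsf{j}'})$ (of size $|J|\times|J|$) are determined by $$\phi_m|_Q=\sum_{\mathsf{j}\in J}c^Q_{m\mathsf{j}}\,\psi^Q_{\mathsf{j}},\qquad \phi_m|_{T_{\mathsf{i}}}=\sum_{\mathsf{j}\in J}c^{\mathsf{i}}_{m\mathsf{j}}\,\zeta^{\mathsf{i}}_{\mathsf{j}},\qquad \psi^Q_{\mathsf{j}}|_{T_{\mathsf{i}}}=\sum_{\mathsf{j}'\in J}b^{\mathsf{i}}_{\mathsf{j}\mathsf{j}'}\,\zeta^{\mathsf{i}}_{\mathsf{j}'},\qquad m=1,\dots,N,\ \mathsf{j}\in J.$$ *)

(* Defs.v *)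
From HB Require Import structures.
From mathcomp Require Import all_boot all_order all_algebra.
From mathcomp Require Import all_classical all_reals all_analysis.
Import Order.TTheory GRing.Theory Num.Theory.
Import numFieldNormedType.Exports.

Set Implicit Arguments.
Unset Strict Implicit.
Unset Printing Implicit Defensive.

Local Open Scope classical_set_scope.
Local Open Scope ring_scope.

(** Points of R^d are row vectors.  The library norm and balls of ['rV[R]_d]
    are those of the maximum norm, which induces the usual topology; wherever
    the Euclidean structure matters, [dotv] and [enorm] are used. *)

Section Euclidean.
Context {R : realType} {d : nat}.
Implicit Types (x y : 'rV[R]_d) (A : set 'rV[R]_d).

Definition dotv x y : R := \sum_(k < d) x ord0 k * y ord0 k.

Definition enorm x : R := Num.sqrt (dotv x x).

Definition boundary A : set 'rV[R]_d := closure A `\` interior A.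

(** Near every boundary point, the set is the strict subgraph, in some unit
    direction [e], of a Lipschitz function [h] of the component orthogonal
    to [e]. *)
Definition lipschitz_boundary A : Prop :=
  forall x, boundary A x ->
  exists (e : 'rV[R]_d) (h : 'rV[R]_d -> R) (r : R),
    [/\ enorm e = 1, lipschitz h, 0 < r &
        forall y, ball x r y -> (A y <-> dotv y e < h (y - dotv y e *: e))].

Definition bounded_lipschitz_domain A : Prop :=
  [/\ A !=set0, open A, connected A, bounded_set A & lipschitz_boundary A].

End Euclidean.

Section Measures.
Context {R : realType} {d : nat}.
Implicit Types (A U : set 'rV[R]_d).

(** R^d with its Borel sigma-algebra. *)
Definition borel_rV := g_sigma_algebraType (@open 'rV[R]_d).

(** Lebesgue and Hausdorff measure are given as outer measures.  They are only
    integrated against over the Borel sigma-algebra, where they are measures;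
    [integral] accepts any set function. *)
Definition lebesgue_rV A : \bar R :=
  ereal_inf [set s | exists a b : nat -> 'rV[R]_d,
    [/\ forall n k, a n ord0 k <= b n ord0 k,
        A `<=` \bigcup_n [set x : 'rV[R]_d | forall k,
                            a n ord0 k <= x ord0 k <= b n ord0 k] &
        s = (\sum_(0 <= n <oo)
               (\prod_(k < d) (b n ord0 k - a n ord0 k))%:E)%E]].

Definition diameter U : \bar R :=
  ereal_sup [set r | exists x y, [/\ U x, U y & r = (enorm (x - y))%:E]].

(** The empty set has weight 0 also in dimension [s = 0], where any other set
    has weight 1. *)
Definition hausdorff_weight (s : nat) U : \bar R :=
  if U == set0 then 0%E else (diameter U ^+ s)%E.

Definition hausdorff_content (s : nat) (delta : R) A : \bar R :=
  ereal_inf [set t | exists U : nat -> set 'rV[R]_d,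
    [/\ forall n, (diameter (U n) <= delta%:E)%E,
        A `<=` \bigcup_n U n &
        t = (\sum_(0 <= n <oo) hausdorff_weight s (U n))%E]].

Definition hausdorff_measure (s : nat) A : \bar R :=
  ereal_sup [set hausdorff_content s delta A | delta in [set e : R | 0 < e]].

(** Surface measure up to a constant factor that depends only on [d], which is
    irrelevant for positivity, null sets and convergence to zero. *)
Definition surface_measure : set 'rV[R]_d -> \bar R := hausdorff_measure d.-1.

End Measures.

Arguments borel_rV R d : clear implicits.

Section Sobolev.
Context {R : realType} {d : nat}.
Implicit Types (D Om Gam : set 'rV[R]_d) (f u v w t phi : 'rV[R]_d -> R)
  (mu : set 'rV[R]_d -> \bar R).

Definition pderiv (k : 'I_d) f : 'rV[R]_d -> R :=
  fun x => 'D_(delta_mx ord0 k) f x.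

Fixpoint of_class_C (n : nat) f : Prop :=
  continuous f /\
  if n is n'.+1 then
    forall k : 'I_d, (forall x, derivable f x (delta_mx ord0 k)) /\
                     of_class_C n' (pderiv k f)
  else True.

Definition smooth f : Prop := forall n, of_class_C n f.

Definition test_function Om phi : Prop :=
  smooth phi /\
  exists K : set 'rV[R]_d, [/\ compact K, K `<=` Om &
                              forall x, ~ K x -> phi x = 0].

Definition integral_rV mu D f : \bar R :=
  @integral _ (borel_rV R d) R mu D (fun x => (f x)%:E).

Definition sq_norm_L2 mu D f : \bar R := integral_rV mu D (fun x => f x ^+ 2).

Definition in_L2 mu D f : Prop :=
  measurable_fun (D : set (borel_rV R d)) (f : borel_rV R d -> R) /\
  (sq_norm_L2 mu D f < +oo)%E.

Definition weak_pderiv Om (k : 'I_d) v w : Prop :=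
  forall phi, test_function Om phi ->
    integral_rV lebesgue_rV Om (fun x => v x * pderiv k phi x) =
    (- integral_rV lebesgue_rV Om (fun x => (w x * phi x)%R))%E.

Definition weak_gradient Om v (g : 'I_d -> 'rV[R]_d -> R) : Prop :=
  forall k, in_L2 lebesgue_rV Om (g k) /\ weak_pderiv Om k v (g k).

Definition in_H1 Om v : Prop :=
  in_L2 lebesgue_rV Om v /\ exists g, weak_gradient Om v g.

Definition cvg_H1 Om (u : nat -> 'rV[R]_d -> R) v : Prop :=
  exists g, [/\ weak_gradient Om v g,
    (sq_norm_L2 lebesgue_rV Om (fun x => u n x - v x)) @[n --> \oo]
      --> 0%E &
    forall k, (sq_norm_L2 lebesgue_rV Om
                 (fun x => pderiv k (u n) x - g k x)) @[n --> \oo] --> 0%E].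

(** The trace operator is the continuous extension to H^1, with values in
    L^2 of the boundary, of the restriction of smooth functions. *)
Definition is_trace Om v t : Prop :=
  in_L2 surface_measure (boundary Om) t /\
  exists u : nat -> 'rV[R]_d -> R,
    [/\ forall n, smooth (u n), cvg_H1 Om u v &
        (sq_norm_L2 surface_measure (boundary Om)
           (fun x => u n x - t x)) @[n --> \oo] --> 0%E].

Definition trace_zero_on Om Gam v : Prop :=
  exists2 t, is_trace Om v t &
             surface_measure (Gam `&` [set x : 'rV[R]_d | t x != 0]) = 0%E.

Definition space_X Om Gam : set ('rV[R]_d -> R) :=
  [set v | in_H1 Om v /\ trace_zero_on Om Gam v].

End Sobolev.

Section FiniteElements.
Context {R : realType} {d : nat}.
Implicit Types (D Q Om Gam : set 'rV[R]_d) (f v : 'rV[R]_d -> R)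
  (Qs : set (set 'rV[R]_d)) (z x : 'rV[R]_d).

Definition ref_cube : set 'rV[R]_d :=
  [set x : 'rV[R]_d | forall k, -1 <= x ord0 k <= 1].

(** [F Q] is the element mapping of the element [Q] of the mesh [Qs]. *)
Definition decomposition Om Qs (F : set 'rV[R]_d -> 'rV[R]_d -> 'rV[R]_d) :
    Prop :=
  [/\ finite_set Qs,
      forall Q, Qs Q -> set_bij ref_cube Q (F Q),
      \bigcup_(Q in Qs) Q = closure Om &
      trivIset Qs (fun Q => interior Q)].

Definition multi_index (r : nat) := {ffun 'I_d -> 'I_r.+1}.

(** The restriction of [f] to the reference cube is a polynomial of degree at
    most [r] in each variable. *)
Definition tensor_poly (r : nat) f : Prop :=
  exists c : multi_index r -> R, forall x, ref_cube x ->
    f x = \sum_(j : multi_index r) c j * \prod_(k < d) x ord0 k ^+ j k.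

(** Functions on the closure of [Om] are total functions on R^d whose values
    elsewhere are irrelevant; membership in the discrete space refers to the
    pointwise representative that is mapped to a polynomial on each element. *)
Definition space_W Om Gam Qs (F : set 'rV[R]_d -> 'rV[R]_d -> 'rV[R]_d)
    (p : set 'rV[R]_d -> nat) : set ('rV[R]_d -> R) :=
  [set v | space_X Om Gam v /\ forall Q, Qs Q -> tensor_poly (p Q) (v \o F Q)].

Definition is_basis_on D (V : set ('rV[R]_d -> R)) (N : nat)
    (phi : 'I_N -> 'rV[R]_d -> R) : Prop :=
  (forall m, V (phi m)) /\
  forall v, V v -> exists! a : 'rV[R]_N,
    forall x, D x -> v x = \sum_(m < N) a ord0 m * phi m x.

(** Rodrigues' formula. *)
Definition legendre (n : nat) : {poly R} :=
  ((2 ^ n * n`!)%:R)^-1 *: (('X^2 - 1) ^+ n)^`(n)%R.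

Definition psi1 (j : nat) (t : R) : R :=
  match j with
  | 0 => (1 - t) / 2
  | 1 => (1 + t) / 2
  | j'.+1 => \int[lebesgue_measure]_(s in `[-1, t]) (legendre j').[s]
  end.

Definition psi_hat (j : 'I_d -> nat) x : R :=
  \prod_(k < d) psi1 (j k) (x ord0 k).

(** [shape_fun F j] is the reference function [psi_hat j] transported by the
    inverse of [F] on the reference cube; it is meaningful on the image
    [F @` ref_cube] when [F] is injective there. *)
Definition shape_fun (F : 'rV[R]_d -> 'rV[R]_d) (j : 'I_d -> nat) :
    'rV[R]_d -> R :=
  psi_hat j \o pinv ref_cube F.

(** In the refinement by [z], [i k] selects the upper half in direction [k]. *)
Definition refined_lo z (i : {ffun 'I_d -> bool}) (k : 'I_d) : R :=
  if i k then z ord0 k else -1.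

Definition refined_hi z (i : {ffun 'I_d -> bool}) (k : 'I_d) : R :=
  if i k then 1 else z ord0 k.

Definition refined_cube z i : set 'rV[R]_d :=
  [set x : 'rV[R]_d | forall k, refined_lo z i k <= x ord0 k <= refined_hi z i k].

Definition refined_affine z i x : 'rV[R]_d :=
  \row_k (refined_lo z i k +
          (refined_hi z i k - refined_lo z i k) * ((x ord0 k + 1) / 2)).

Definition refined_element (F : 'rV[R]_d -> 'rV[R]_d) z i : set 'rV[R]_d :=
  F @` refined_cube z i.

Definition refined_map (F : 'rV[R]_d -> 'rV[R]_d) z i : 'rV[R]_d -> 'rV[R]_d :=
  F \o refined_affine z i.

(** Row [m] of [M] holds the coefficients of [f m], restricted to [D], with
    respect to the functions [g]. *)
Definition represents_on D (a b : nat) (f : 'I_a -> 'rV[R]_d -> R)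
    (g : 'I_b -> 'rV[R]_d -> R) (M : 'M[R]_(a, b)) : Prop :=
  forall m x, D x -> f m x = \sum_(j < b) M m j * g j x.

End FiniteElements.

Arguments multi_index d r : clear implicits.

(* Main.v *)
Require Import Defs.
From HB Require Import structures.
From mathcomp Require Import all_boot all_order all_algebra.
From mathcomp Require Import all_classical all_reals all_analysis.
From mathcomp Require Import ring lra.
Import Order.TTheory GRing.Theory Num.Theory.
Import numFieldNormedType.Exports.
Local Open Scope classical_set_scope.
Local Open Scope ring_scope.

(** On [T_i] the functions [phi_m] have two expansions in the functions
    [zeta_j]: one with the coefficients [C_i], and one with [C_Q *m B_i],
    obtained by substituting the expansion of the [psi_j] in the [zeta_j] into
    that of [phi_m] in the [psi_j] ([represents_on_mulmx]).  The formula thus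
    says that the [zeta_j] are linearly independent on [T_i].

    Transport to the reference cube reduces this to the linear independence of
    the tensor products [psi_hat] ([psi_hat_free], [shape_fun_free]).  The
    one-dimensional functions [psi1 0], ..., [psi1 P] agree between -1 and 1 with
    polynomials that are linearly independent: only the first does not vanish at
    -1, and the others have strictly increasing degrees ([psi_poly_free]).  As
    their degrees are at most [P + 1], sampling at [P + 2] points keeps them
    independent, so each coefficient of a combination of the [psi1 j] is a
    weighted sum of sampled values ([psi1_dual]).  In dimension [d] the product
    weights on the product grid recover the coefficients in the same way. *)

(** * One-dimensional functions as polynomials *)

Section OneDimension.
Context {R : realType}.
Implicit Types (p : {poly R}) (t : R).

(** The constant coefficient is 0 because [0^-1 = 0]. *)
Definition antideriv p : {poly R} :=
  \poly_(i < (size p).+1) (p`_i.-1 / i%:R).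

Lemma deriv_antideriv p : (antideriv p)^`() = p.
Proof.
apply/polyP => i; rewrite coef_deriv coef_poly ltnS.
case: ltnP => [_ | p_le_i] /=; last by rewrite mul0rn nth_default.
by rewrite -[LHS]mulr_natr divfK // pnatr_eq0.
Qed.

Lemma size_antideriv p : p != 0 -> size (antideriv p) = (size p).+1.
Proof.
move=> p0; apply: size_poly_eq => /=.
rewrite mulf_neq0 ?invr_eq0 ?pnatr_eq0 ?size_poly_eq0 //.
by rewrite -lead_coefE lead_coef_eq0.
Qed.

Lemma Rintegral_horner p t : -1 <= t ->
  \int[lebesgue_measure]_(s in `[-1, t]) p.[s] =
  (antideriv p).[t] - (antideriv p).[-1].
Proof.
rewrite le_eqVlt => /predU1P[<- | t_gt].
  by rewrite set_itv1 Rintegral_set1 subrr.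
rewrite /Rintegral (@continuous_FTC2 _ _ (horner (antideriv p))) //.
- by apply: continuous_subspaceT => x; exact: continuous_horner.
- split; first by move=> x _; exact: derivable_horner.
  + by apply: cvg_at_right_filter; exact: continuous_horner.
  + by apply: cvg_at_left_filter; exact: continuous_horner.
- by move=> x _; rewrite -derivE deriv_antideriv.
Qed.

Lemma size_legendre n : size (legendre n : {poly R}) = n.+1.
Proof.
have c_neq0 : ((2 ^ n * n`!)%:R : R)^-1 != 0.
  by rewrite invr_eq0 pnatr_eq0 -lt0n muln_gt0 expn_gt0 fact_gt0.
rewrite /legendre size_scale //.
have monicX : ('X^2 - 1 : {poly R}) \is monic.
  by rewrite monicXnsubC.
have sz : size (('X^2 - 1 : {poly R}) ^+ n) = (n + n).+1.
  have := size_exp ('X^2 - 1 : {poly R}) n.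
  rewrite size_XnsubC // mul2n -addnn => <-.
  by rewrite prednK // size_poly_gt0 monic_neq0 // monic_exp.
apply/eqP; rewrite eqn_leq; apply/andP; split.
  apply/leq_sizeP => j n_le_j; rewrite coef_derivn nth_default ?mul0rn //.
  by rewrite sz -addnS leq_add2l.
rewrite ltnNge; apply/negP => /leq_sizeP/(_ n (leqnn n))/eqP.
rewrite coef_derivn mulrn_eq0 eqn0Ngt ffact_gt0 leq_addr /=.
have -> : (('X^2 - 1 : {poly R}) ^+ n)`_(n + n) = 1.
  by have /monicP := monic_exp n monicX; rewrite lead_coefE sz.
by rewrite oner_eq0.
Qed.

Definition psi_poly (j : nat) : {poly R} :=
  match j with
  | 0 => 2^-1 *: (1 - 'X)
  | 1 => 2^-1 *: (1 + 'X)
  | j'.+1 => antideriv (legendre j') - (antideriv (legendre j')).[-1]%:P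
  end.

Lemma psi1_horner j t : -1 <= t -> psi1 j t = (psi_poly j).[t].
Proof.
case: j => [|[|j]] t_ge; rewrite /psi1 /psi_poly.
- by rewrite !hornerE mulrC.
- by rewrite !hornerE mulrC.
- by rewrite Rintegral_horner // !hornerE.
Qed.

Lemma size_psi_polyS j : size (psi_poly j.+1) = j.+2.
Proof.
case: j => [|j] /=.
  by rewrite size_scale ?invr_eq0 ?pnatr_eq0 // addrC size_XaddC.
have sz : size (antideriv (legendre j.+1 : {poly R})) = j.+3.
  by rewrite size_antideriv ?size_legendre // -size_poly_eq0 size_legendre.
by rewrite size_polyDl sz // size_polyN (leq_ltn_trans (size_polyC_leq1 _)).
Qed.

Lemma size_psi_poly_le P (j : 'I_P.+1) : (size (psi_poly j) <= P.+2)%N.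
Proof.
case: j => [[|j] jP] /=; last by rewrite size_psi_polyS ltnW.
apply: leq_trans (size_scale_leq _ _) _; rewrite -size_polyN opprB size_XsubC //.
Qed.

Lemma psi_poly0_N1 : (psi_poly 0).[-1] = 1.
Proof. by rewrite !hornerE /=; field. Qed.

Lemma psi_polyS_N1 j : (psi_poly j.+1).[-1] = 0.
Proof. by case: j => [|j]; rewrite /= !hornerE; [field | rewrite subrr]. Qed.

(** The summand of largest size among those with a nonzero coefficient cannot
    be cancelled by the others. *)
Lemma increasing_size_free (q : nat -> {poly R}) n (u : 'I_n -> R) :
  (forall i, q i != 0) ->
  (forall i j, (i < j)%N -> (size (q i) < size (q j))%N) ->
  \sum_(i < n) u i *: q i = 0 -> forall i, u i = 0.
Proof.
move=> q0 q_incr; elim: n u => [|n IHn] u; first by move=> _ [].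
rewrite big_ord_recr /= => sum0.
have un0 : u ord_max = 0.
  apply/eqP; apply: contraT => un.
  have lt : (size (\sum_(i < n) u (widen_ord (leqnSn n) i) *: q i)%R
             < size (u ord_max *: q n)%R)%N.
    rewrite size_scale //; apply: (leq_ltn_trans (size_sum _ _ _)).
    have qn_gt0 : (0 < size (q n))%N by rewrite lt0n size_poly_eq0.
    rewrite -(prednK qn_gt0) ltnS; apply/bigmax_leqP => i _.
    apply: leq_trans (size_scale_leq _ _) _.
    by rewrite -ltnS (prednK qn_gt0) q_incr.
  by move/eqP: sum0 lt; rewrite addr_eq0 => /eqP ->; rewrite size_polyN ltnn.
move: sum0; rewrite un0 scale0r addr0 => /IHn u0 i.
case: (unliftP ord_max i) => [j ->|->] //.
by rewrite -(u0 j); congr u; apply/val_inj/lift_max.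
Qed.

(** The degrees alone do not suffice, as [psi_poly 0] and [psi_poly 1] both have
    degree 1; evaluation at -1 isolates the coefficient of [psi_poly 0]. *)
Lemma psi_poly_free P (u : 'I_P.+1 -> R) :
  \sum_(j < P.+1) u j *: psi_poly j = 0 -> forall j, u j = 0.
Proof.
rewrite big_ord_recl => sum0.
have u0 : u ord0 = 0.
  move: (congr1 (fun q => q.[-1]) sum0); rewrite hornerD horner_sum big1.
    by rewrite hornerZ psi_poly0_N1 mulr1 addr0 horner0.
  by move=> j _; rewrite hornerZ psi_polyS_N1 mulr0.
move: sum0; rewrite u0 scale0r add0r => sum0 j.
case: (unliftP ord0 j) => [k ->|-> //].
apply: (@increasing_size_free (fun k => psi_poly k.+1) P
          (fun k => u (lift ord0 k))) => //.
  by move=> i; rewrite -size_poly_eq0 size_psi_polyS.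
by move=> a b ab; rewrite !size_psi_polyS.
Qed.

(** * Recovering coefficients from sampled values *)

(** The rows of [W] are functionals dual to the [psi1 j]: a left inverse of the
    matrix of sampled values.  There are [P + 2] sample points rather than
    [P + 1] because for [P = 0] the only function has degree 1 and could vanish
    at a single point. *)
Lemma psi1_dual P : exists (t : 'I_P.+2 -> R) (W : 'M[R]_(P.+1, P.+2)),
  (forall a, -1 <= t a <= 1) /\
  forall l j : 'I_P.+1, \sum_a W l a * psi1 j (t a) = (j == l)%:R.
Proof.
pose t (a : 'I_P.+2) : R := 2 * (a%:R / P.+1%:R) - 1.
have P_gt0 : 0 < P.+1%:R :> R by rewrite ltr0n.
have t_in a : -1 <= t a <= 1.
  have a_ge0 : 0 <= a%:R / P.+1%:R :> R by rewrite divr_ge0 ?ler0n.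
  have a_le1 : a%:R / P.+1%:R <= 1 :> R.
    by rewrite ler_pdivrMr // mul1r ler_nat -ltnS.
  rewrite /t; move: (a%:R / _) a_ge0 a_le1 => s s_ge0 s_le1.
  by apply/andP; split; lra.
have t_inj : injective t.
  move=> a b; rewrite /t => /addIr /(mulfI _) tab.
  have {}tab : a%:R / P.+1%:R = b%:R / P.+1%:R :> R.
    by apply: tab; rewrite pnatr_eq0.
  have : a%:R = b%:R :> R by apply: (mulIf _ tab); rewrite invr_eq0 gt_eqF.
  by move/eqP; rewrite eqr_nat => /eqP/val_inj.
pose V : 'M[R]_(P.+1, P.+2) := \matrix_(j, a) psi1 j (t a).
have /row_freeP[B VB1] : row_free V.
  apply: inj_row_free => v vV0; apply/rowP => j; rewrite mxE.
  (* A combination of degree at most P + 1 that vanishes at P + 2 points. *)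
  apply: (@psi_poly_free P (fun j => v ord0 j)).
  apply: (@roots_geq_poly_eq0 _ _ (codom t)).
  - apply/allP => _ /codomP[a ->]; apply/rootP.
    have := congr1 (fun M : 'M[R]_(1, P.+2) => M ord0 a) vV0; rewrite !mxE => v0.
    rewrite horner_sum -[RHS]v0; apply: eq_bigr => i _.
    by rewrite hornerZ mxE psi1_horner //; case/andP: (t_in a).
  - by rewrite map_inj_uniq ?enum_uniq.
  - rewrite size_codom card_ord (leq_trans (size_sum _ _ _)) //.
    apply/bigmax_leqP => i _.
    exact: leq_trans (size_scale_leq _ _) (size_psi_poly_le _ _).
exists t, B^T; split => // l j.
have := congr1 (fun M : 'M[R]_(P.+1, P.+1) => M j l) VB1; rewrite !mxE => <-.
by apply: eq_bigr => a _; rewrite !mxE mulrC.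
Qed.

End OneDimension.

Section TensorProducts.
Context {R : realType} {d : nat}.
Implicit Types (G : 'rV[R]_d -> 'rV[R]_d).

(** Products of the one-dimensional dual functionals are dual to the tensor
    products. *)
Lemma psi_hat_free P (c : multi_index d P -> R) :
  (forall x, ref_cube x ->
     \sum_(j : multi_index d P) c j * psi_hat (fun k => j k) x = 0) ->
  forall j, c j = 0.
Proof.
have [t [W [t_in WE]]] := @psi1_dual R P.
move=> sum0 l.
pose pt (a : {ffun 'I_d -> 'I_P.+2}) : 'rV[R]_d := \row_k t (a k).
have pt_in a : ref_cube (pt a) by move=> k; rewrite mxE.
(* Sum over the product grid with the product weights of row l, then factor
   the sum over the grid into one-dimensional sums. *)
have : \sum_(a : {ffun 'I_d -> 'I_P.+2}) (\prod_k W (l k) (a k)) *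
         (\sum_(j : multi_index d P) c j * psi_hat (fun k => j k) (pt a)) = 0.
  by rewrite big1 // => a _; rewrite sum0 // mulr0.
under eq_bigr do rewrite mulr_sumr.
rewrite exchange_big /= => <-.
rewrite (bigD1 l) //= [X in _ + X]big1 ?addr0 => [|j jl].
- transitivity (c l * \prod_(k < d) \sum_a W (l k) a * psi1 (l k) (t a)).
    by rewrite big1 ?mulr1 // => k _; rewrite WE eqxx.
  rewrite bigA_distr_bigA mulr_sumr; apply: eq_bigr => a _.
  rewrite big_split mulrCA; congr (_ * (_ * _)).
  by apply: eq_bigr => k _; rewrite mxE.
- transitivity (c j * \prod_(k < d) \sum_a W (l k) a * psi1 (j k) (t a)).
    rewrite bigA_distr_bigA mulr_sumr; apply: eq_bigr => a _.
    rewrite big_split mulrCA; congr (_ * (_ * _)).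
    by apply: eq_bigr => k _; rewrite mxE.
  have [k jlk] : exists k, j k != l k.
    apply/existsP; apply: contraNT jl; rewrite negb_exists => /forallP jl.
    by apply/eqP/ffunP => k; apply/eqP; rewrite -[_ == _]negbK.
  by rewrite (bigD1 k) //= WE (negbTE jlk) mul0r mulr0.
Qed.

(** * Transported functions and changes of basis *)

Lemma shape_fun_free G P n (J : 'I_n -> multi_index d P) (a : 'I_n -> R) :
  {in ref_cube &, injective G} -> bijective J ->
  (forall x, (G @` ref_cube) x ->
     \sum_l a l * shape_fun G (fun k => J l k) x = 0) ->
  forall l, a l = 0.
Proof.
move=> G_inj [K JK KJ] sum0 l; rewrite -[l]JK.
apply: (@psi_hat_free P (a \o K)) => y y_in.
rewrite (reindex J) /=; last by exists K => j _; rewrite ?JK ?KJ.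
rewrite -[RHS](sum0 (G y)); last by exists y.
by apply: eq_bigr => m _; rewrite JK /shape_fun /= pinvKV // inE.
Qed.

Lemma represents_on_mulmx (D : set 'rV[R]_d) (a b c : nat)
    (f : 'I_a -> 'rV[R]_d -> R) (g : 'I_b -> 'rV[R]_d -> R)
    (h : 'I_c -> 'rV[R]_d -> R) (M : 'M[R]_(a, b)) (M' : 'M[R]_(b, c)) :
  represents_on D f g M -> represents_on D g h M' ->
  represents_on D f h (M *m M').
Proof.
move=> fg gh m x Dx; rewrite fg //.
under eq_bigr do rewrite gh // mulr_sumr.
rewrite exchange_big /=; apply: eq_bigr => j _.
by rewrite mxE mulr_suml; apply: eq_bigr => l _; rewrite mulrA.
Qed.

Lemma represents_on_shape_fun_inj G P n (J : 'I_n -> multi_index d P) (N : nat)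
    (f : 'I_N -> 'rV[R]_d -> R) (M M' : 'M[R]_(N, n)) :
  {in ref_cube &, injective G} -> bijective J ->
  represents_on (G @` ref_cube) f
    (fun l => shape_fun G (fun k => J l k)) M ->
  represents_on (G @` ref_cube) f
    (fun l => shape_fun G (fun k => J l k)) M' ->
  M = M'.
Proof.
move=> G_inj J_bij fM fM'; apply/matrixP => m l; apply/subr0_eq.
apply: (@shape_fun_free G P n J (fun l => M m l - M' m l)) => // x xG.
under eq_bigr do rewrite mulrBl.
by rewrite sumrB -fM // -fM' // subrr.
Qed.

(** * Refinement of the reference cube *)

Context (z : 'rV[R]_d) (i : {ffun 'I_d -> bool}).
Hypothesis z_in : forall k, -1 < z ord0 k < 1.

Let refined_lt k : refined_lo z i k < refined_hi z i k.
Proof.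
by have /andP[] := z_in k; rewrite /refined_lo /refined_hi; case: (i k).
Qed.

Lemma refined_affine_inj : injective (refined_affine z i).
Proof.
move=> x y /rowP xy; apply/rowP => k; move: (xy k); rewrite !mxE.
have h0 : refined_hi z i k - refined_lo z i k != 0.
  by rewrite subr_eq0 gt_eqF.
move=> /addrI /(mulfI h0) /mulIf half.
by apply: (@addIr _ 1); apply: half; rewrite invr_eq0 pnatr_eq0.
Qed.

Lemma refined_affine_cube x :
  ref_cube x -> refined_cube z i (refined_affine z i x).
Proof.
move=> x_in k; rewrite mxE; have := refined_lt k; have := x_in k.
by move=> /andP[x_ge x_le] lt; apply/andP; split; nra.
Qed.

Lemma refined_cube_sub : refined_cube z i `<=` ref_cube.
Proof.
move=> x x_in k; have := x_in k; rewrite /refined_lo /refined_hi.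
have /andP[z_gt z_lt] := z_in k.
by case: (i k) => /andP[lo hi]; apply/andP; split; lra.
Qed.

End TensorProducts.

Theorem theorem19 (R : realType) (d : nat) (d_gt0 : (0 < d)%N)
  (Om : set 'rV[R]_d) (Om_dom : bounded_lipschitz_domain Om)
  (Qs : set (set 'rV[R]_d)) (F : set 'rV[R]_d -> 'rV[R]_d -> 'rV[R]_d)
  (Qs_dec : decomposition Om Qs F)
  (Gam : set 'rV[R]_d) (Gam_sub : Gam `<=` boundary Om)
  (Gam_pos : (0 < surface_measure Gam)%E)
  (p : set 'rV[R]_d -> nat)
  (N : nat) (phi : 'I_N -> 'rV[R]_d -> R)
  (phi_basis : is_basis_on (closure Om) (space_W Om Gam Qs F p) phi)
  (Q : set 'rV[R]_d) (QsQ : Qs Q)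
  (z : 'rV[R]_d) (z_in : forall k, -1 < z ord0 k < 1)
  (P : nat) (pQ_le_P : (p Q <= P)%N)
  (n : nat) (J : 'I_n -> multi_index d P) (J_enum : bijective J)
  (CQ : 'M[R]_(N, n))
  (CQ_def : represents_on Q phi (fun l => shape_fun (F Q) (fun k => J l k)) CQ)
  (i : {ffun 'I_d -> bool})
  (Ci : 'M[R]_(N, n))
  (Ci_def : represents_on (refined_element (F Q) z i) phi
              (fun l => shape_fun (refined_map (F Q) z i) (fun k => J l k)) Ci)
  (Bi : 'M[R]_(n, n))
  (Bi_def : represents_on (refined_element (F Q) z i)
              (fun l => shape_fun (F Q) (fun k => J l k))
              (fun l => shape_fun (refined_map (F Q) z i) (fun k => J l k)) Bi) :
  Ci = CQ *m Bi.
Proof.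
have [_ /(_ Q QsQ)[FQ_fun FQ_inj _] _ _] := Qs_dec.
have aff_in x : ref_cube x -> ref_cube (refined_affine z i x).
  by move=> x_in; apply: (refined_cube_sub z i z_in); exact: refined_affine_cube.
have image_sub : refined_map (F Q) z i @` ref_cube
                 `<=` refined_element (F Q) z i.
  move=> _ [x x_in <-]; exists (refined_affine z i x) => //.
  exact: refined_affine_cube.
have map_inj : {in ref_cube &, injective (refined_map (F Q) z i)}.
  move=> x y /set_mem x_in /set_mem y_in.
  move=> /FQ_inj xy; apply: (refined_affine_inj z i z_in).
  by apply: xy; apply/mem_set/aff_in.
apply: (represents_on_shape_fun_inj _ _ _ _ _ _ _ _ map_inj J_enum).
  by move=> m x /image_sub; exact: Ci_def.
have CQ_sub : represents_on (refined_element (F Q) z i) phi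
                (fun l => shape_fun (F Q) (fun k => J l k)) CQ.
  move=> m _ [y y_in <-]; apply: CQ_def; apply: FQ_fun.
  exact: (refined_cube_sub z i z_in).
by move=> m x /image_sub; exact: (represents_on_mulmx _ _ _ _ _ _ _ _ _ CQ_sub Bi_def).
Qed.
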